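(* Let $p\ge 1$, let $C:\mathbb{Z}\to M_{p\times p}(\mathbb{R})$ be discrete almost automorphic with $C(n)$ invertible for every $n\in\mathbb{Z}$, and let $f\in AA(\mathbb{Z},\mathbb{C}^p)$. Suppose that the homogeneous equation $x(n+1)=C(n)x(n)$, $n\in\mathbb{Z}$, has an exponential dichotomy with parameters $(\alpha,K,P)$ and that the associated discrete Green function $G(\cdot,\cdot)$ is discrete Bi-almost automorphic. Then the equation $$x(n+1)=C(n)x(n)+f(n),\quad n\in\mathbb{Z},$$ has a unique discrete almost automorphic solution; it is given by $$x(n)=\sum_{k\in\mathbb{Z}}G(n,k+1)f(k),\quad n\in\mathbb{Z},$$ and it satisfies $$|x(n)|\le K(1+e^{-\alpha})(1-e^{-\alpha})^{-1}\|f\|_\infty,\quad n\in\mathbb{Z}.$$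
   Context: Let $\mathbb{X}$ be a Banach space. A function $f:\mathbb{Z}\to\mathbb{X}$ is discrete almost automorphic, written $f\in AA(\mathbb{Z},\mathbb{X})$, if for any sequence $\{s_n'\}_{n\in\mathbb{N}}\subseteq\mathbb{Z}$ there exist a subsequence $\{s_n\}_{n\in\mathbb{N}}$ of $\{s_n'\}$ and a function $\tilde f:\mathbb{Z}\to\mathbb{X}$ such that $\lim_{n\to\infty}f(k+s_n)=\tilde f(k)$ and $\lim_{n\to\infty}\tilde f(k-s_n)=f(k)$ for every $k\in\mathbb{Z}$ (pointwise limits). A function $H:\mathbb{Z}\times\mathbb{Z}\to\mathbb{X}$ is discrete Bi-almost automorphic if for any sequence $\{s_n'\}_{n\in\mathbb{N}}\subseteq\mathbb{Z}$ there exist a subsequence $\{s_n\}_{n\in\mathbb{N}}$ of $\{s_n'\}$ and a function $\tilde H:\mathbb{Z}\times\mathbb{Z}\to\mathbb{X}$ such that $\lim_{n\to\infty}H(k+s_n,m+s_n)=\tilde H(k,m)$ and $\lim_{n\to\infty}\tilde H(k-s_n,m-s_n)=H(k,m)$ for all $k,m\in\mathbb{Z}$. Exponential dichotomy: let $C(n)$, $n\in\mathbb{Z}$, be invertible and let $Y(n)$, $n\in\mathbb{Z}$, be a fixed fundamental matrix solution of $x(n+1)=C(n)x(n)$. This equation has an exponential dichotomy with parameters $(\alpha,K,P)$ if $\alpha,K>0$ are constants and $P$ is a projection (constant matrix with $P^2=P$) such that $|G(m,l)|\le Ke^{-\alpha|m-l|}$ for all $m,l\in\mathbb{Z}$, where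 the discrete Green function is $$G(m,l)=\begin{cases}Y(m)PY^{-1}(l), & m\ge l,\\ -Y(m)(I-P)Y^{-1}(l), & m<l.\end{cases}$$ Here $|\cdot|$ denotes a norm on $\mathbb{C}^p$ and the corresponding matrix norm, and $\|f\|_\infty=\sup_{n\in\mathbb{Z}}|f(n)|$. *)

(* Defs.v *)
From HB Require Import structures.
From mathcomp Require Import all_boot all_order all_algebra.
From mathcomp Require Import all_classical all_reals all_analysis.
From mathcomp Require Import complex.

Set Implicit Arguments.
Unset Strict Implicit.
Unset Printing Implicit Defensive.

Import Order.TTheory GRing.Theory Num.Theory.
Import numFieldNormedType.Exports.
Local Open Scope classical_set_scope.
Local Open Scope ring_scope.
Local Open Scope complex_scope.

(* The norm on C^p is arbitrary, so it is a parameter: the topology used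
   throughout is the one of that norm, not of the library's canonical sup norm
   on matrices.  Nonnegativity and N 0 = 0 follow from these axioms. *)
Definition is_norm (R : realType) (p : nat) (N : 'cV[R[i]]_p -> R) : Prop :=
  [/\ forall u v, N (u + v) <= N u + N v,
      forall (a : R[i]) v, N (a *: v) = Normc.normc a * N v
    & forall v, N v = 0 -> v = 0].

(* In finite dimension the set below is bounded, so [sup] is the true
   supremum. *)
Definition opnorm (R : realType) (p : nat) (N : 'cV[R[i]]_p -> R)
    (A : 'M[R[i]]_p) : R :=
  sup [set N (A *m v) | v in [set v | N v <= 1]].

Definition complexify (R : realType) (p : nat) (A : 'M[R]_p) : 'M[R[i]]_p :=
  map_mx (real_complex R) A.

Definition norm_cvg (R : realType) (V : zmodType) (nu : V -> R)
    (u : nat -> V) (l : V) : Prop :=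
  nu (u n - l) @[n --> \oo] --> (0 : R).

Definition almost_automorphic (R : realType) (V : zmodType) (nu : V -> R)
    (f : int -> V) : Prop :=
  forall s' : nat -> int,
  exists2 phi : nat -> nat, {homo phi : i j / (i < j)%N} &
  exists ft : int -> V, forall k : int,
    norm_cvg nu (fun n => f (k + s' (phi n))) (ft k) /\
    norm_cvg nu (fun n => ft (k - s' (phi n))) (f k).

Definition bi_almost_automorphic (R : realType) (V : zmodType) (nu : V -> R)
    (H : int -> int -> V) : Prop :=
  forall s' : nat -> int,
  exists2 phi : nat -> nat, {homo phi : i j / (i < j)%N} &
  exists Ht : int -> int -> V, forall k m : int,
    norm_cvg nu (fun n => H (k + s' (phi n)) (m + s' (phi n))) (Ht k m) /\
    norm_cvg nu (fun n => Ht (k - s' (phi n)) (m - s' (phi n))) (H k m).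

Definition fundamental_matrix (R : realType) (p : nat)
    (C Y : int -> 'M[R[i]]_p) : Prop :=
  forall n, Y n \in unitmx /\ Y (n + 1) = C n *m Y n.

Definition green (R : realType) (p : nat) (Y : int -> 'M[R[i]]_p)
    (P : 'M[R[i]]_p) (m l : int) : 'M[R[i]]_p :=
  if l <= m then Y m *m P *m invmx (Y l)
  else - (Y m *m (1%:M - P) *m invmx (Y l)).

(* Exponential dichotomy of x(n+1) = C(n) x(n), relative to the fixed
   fundamental matrix solution Y. *)
Definition exp_dichotomy (R : realType) (p : nat) (N : 'cV[R[i]]_p -> R)
    (C Y : int -> 'M[R[i]]_p) (alpha K : R) (P : 'M[R[i]]_p) : Prop :=
  [/\ fundamental_matrix C Y, 0 < alpha, 0 < K, P *m P = P
    & forall m l : int,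
        opnorm N (green Y P m l) <= K * expR (- alpha * `|m - l|%:~R)].

(* Both one-sided series converge; the indices Negz j = - (j + 1) are the
   negative ones. *)
Definition int_sum (R : realType) (V : zmodType) (nu : V -> R)
    (u : int -> V) (s : V) : Prop :=
  exists a b : V,
    [/\ norm_cvg nu (series (fun j : nat => u (Posz j))) a,
        norm_cvg nu (series (fun j : nat => u (Negz j))) b
      & s = a + b].

Definition sup_norm (R : realType) (V : Type) (nu : V -> R) (f : int -> V) : R :=
  sup (range (fun n => nu (f n))).

Definition is_solution (R : realType) (p : nat) (C : int -> 'M[R[i]]_p)
    (f x : int -> 'cV[R[i]]_p) : Prop :=
  forall n, x (n + 1) = C n *m x n + f n.

(* Main.v *)
Require Import Defs.
From mathcomp Require Import all_boot all_order all_algebra.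
From mathcomp Require Import all_classical all_reals all_analysis.
From mathcomp Require Import complex.
From mathcomp Require Import ring zify.
Import Order.TTheory GRing.Theory Num.Theory.
Import numFieldNormedType.Exports.
Local Open Scope classical_set_scope.
Local Open Scope ring_scope.
Local Open Scope complex_scope.

Set Implicit Arguments.
Unset Strict Implicit.
Unset Printing Implicit Defensive.

(** Why the theorem is true.  Write G for the Green function of the dichotomy
    and q = exp (- alpha) < 1, so that |G(m,l)| <= K q^|m-l|.

    Existence.  Centring the series at n splits sum_k G(n,k+1) f(k) into the
    past sum_(j>=0) G(n,n-j) f(n-j-1) and the future
    sum_(j>=0) G(n,n+1+j) f(n+j).  Both are dominated by geometric series
    ([past_term_le], [future_term_le]), hence converge, and adding the two
    geometric sums gives the announced bound ([green_conv_le]).  The identity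
    G(n+1,l) = C(n) G(n,l) + [l = n+1] I turns the value x(n) of this sum into
    a solution ([green_conv_solution]).  In the centred form, translating n by
    s amounts to translating both arguments of G and the argument of f by s
    ([green_conv_shift]).  So if G and f converge along translations s_n, then
    x(n + s_n) is a sequence of dominated series that converges term by term,
    and the sums converge ([green_conv_cvg]); doing this for the translations
    and then for their inverses shows that x is almost automorphic
    ([green_conv_almost_automorphic]).

    Uniqueness.  An almost automorphic function is bounded
    ([almost_automorphic_bounded]).  If x is a bounded solution, the dual
    identity G(n,k+1) C(k) = G(n,k) - [k = n] I gives
      G(n,k+1) f(k) = G(n,k+1) x(k+1) - G(n,k) x(k) + [k = n] x(n),
    so the series telescopes, its end terms vanish exponentially, and its sum
    is x(n) ([bounded_solution_int_sum]).  This gives the representation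
    formula, and uniqueness with it.

    Everything is measured with an arbitrary norm N on C^p.  Two facts about N
    use that the dimension is finite: an absolutely convergent series
    converges, and |A v| <= |A| |v| for the operator norm, which is a supremum
    and must be known to be finite.  Both come from the domination of the real
    coordinates by N ([real_coords_le_norm]). *)

(** * Elementary properties of a norm on complex column vectors *)

Section NormBasics.
Context {R : realType} {p : nat} (N : 'cV[R[i]]_p -> R) (hN : is_norm N).
Implicit Types (u v : 'cV[R[i]]_p) (A : 'M[R[i]]_p).

Lemma normc_real (a : R) : Normc.normc a%:C = `|a|.
Proof. by rewrite /Normc.normc /= expr0n /= addr0 sqrtr_sqr. Qed.

Lemma is_normD u v : N (u + v) <= N u + N v.
Proof. by case: hN. Qed.

Lemma is_normZ (a : R[i]) v : N (a *: v) = Normc.normc a * N v.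
Proof. by case: hN. Qed.

Lemma is_norm_eq0 v : N v = 0 -> v = 0.
Proof. by case: hN => _ _; apply. Qed.

Lemma is_norm0 : N 0 = 0.
Proof. by rewrite -(scale0r 0) is_normZ Normc.normc0 mul0r. Qed.

Lemma is_normN v : N (- v) = N v.
Proof.
by rewrite -scaleN1r is_normZ (normcN (1 : Rcomplex R)) Normc.normc1 mul1r.
Qed.

Lemma is_norm_ge0 v : 0 <= N v.
Proof.
have := is_normD v (- v); rewrite subrr is_norm0 is_normN.
by rewrite -mulr2n pmulrn_lge0.
Qed.

Lemma is_normB u v : N (u - v) <= N u + N v.
Proof. by rewrite -(is_normN v) is_normD. Qed.

Lemma is_norm_sum (I : Type) (r : seq I) (Q : pred I) (F : I -> 'cV[R[i]]_p) :
  N (\sum_(i <- r | Q i) F i) <= \sum_(i <- r | Q i) N (F i).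
Proof.
elim/big_ind2 : _ => //; first by rewrite is_norm0.
by move=> x1 x2 y1 y2 h1 h2; apply: le_trans (is_normD _ _) (lerD h1 h2).
Qed.

Lemma mulmx_norm_coord_le A v :
  N (A *m v) <= \sum_j Normc.normc (v j 0) * N (col j A).
Proof.
have -> : A *m v = \sum_j v j 0 *: col j A.
  apply/colP => i; rewrite mxE summxE; apply: eq_bigr => j _.
  by rewrite !mxE mulrC.
apply: le_trans (is_norm_sum _ _ _) _.
by apply: ler_sum => j _; rewrite is_normZ.
Qed.

End NormBasics.

(** * Comparison with the real coordinates, and the operator norm *)

Section NormEquivalence.
Context {R : realType} {p : nat} (N : 'cV[R[i]]_p -> R) (hN : is_norm N).

(** Complex vectors are identified with real vectors of twice the length in
    order to use the compactness of the unit sphere of a real space. *)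
Definition of_real_coords (w : 'rV[R]_(p + p)) : 'cV[R[i]]_p :=
  \col_i (w 0 (lshift p i) +i* w 0 (rshift p i)).

Definition real_coords (v : 'cV[R[i]]_p) : 'rV[R]_(p + p) :=
  row_mx (\row_i complex.Re (v i 0)) (\row_i complex.Im (v i 0)).

Lemma real_coordsK v : of_real_coords (real_coords v) = v.
Proof.
apply/colP => i; rewrite mxE row_mxEl row_mxEr !mxE.
by case: (v i 0).
Qed.

Lemma of_real_coordsK w : real_coords (of_real_coords w) = w.
Proof.
apply/rowP => k; rewrite -(splitK k); case: (fintype.split k) => i /=.
  by rewrite row_mxEl !mxE.
by rewrite row_mxEr !mxE.
Qed.

Lemma of_real_coordsD w1 w2 :
  of_real_coords (w1 + w2) = of_real_coords w1 + of_real_coords w2.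
Proof. by apply/colP => i; rewrite !mxE. Qed.

Lemma of_real_coordsZ (a : R) w :
  of_real_coords (a *: w) = a%:C *: of_real_coords w.
Proof.
apply/colP => i; rewrite !mxE; apply/eqP; rewrite eq_complex /=.
by rewrite !mul0r subr0 addr0 !eqxx.
Qed.

Lemma of_real_coordsN w : of_real_coords (- w) = - of_real_coords w.
Proof. by apply/colP => i; rewrite !mxE. Qed.

Lemma of_real_coords0 : of_real_coords 0 = 0.
Proof. by apply/colP => i; rewrite !mxE. Qed.

Lemma real_coordsD v1 v2 :
  real_coords (v1 + v2) = real_coords v1 + real_coords v2.
Proof.
apply: (can_inj of_real_coordsK).
by rewrite -[v1]real_coordsK -[v2]real_coordsK -of_real_coordsD !of_real_coordsK.
Qed.

Lemma coord_le_norm n (w : 'rV[R]_n) k : `|w 0 k| <= `|w|.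
Proof.
rewrite [leRHS]/Num.norm /= mx_normrE.
exact: (le_bigmax _ (fun ij : 'I_1 * 'I_n => `|w ij.1 ij.2|) (0, k)).
Qed.

Lemma normc_le_ReIm (a b : R) : Normc.normc (a +i* b) <= `|a| + `|b|.
Proof.
have -> : a +i* b = a%:C + (0 +i* b).
  by apply/eqP; rewrite eq_complex /= addr0 add0r !eqxx.
apply: le_trans (le_normcD (_ : Rcomplex R) _) _; rewrite normc_real lerD2l.
by rewrite /Normc.normc expr0n /= add0r sqrtr_sqr.
Qed.

Lemma norm_of_real_coords_le : exists2 c : R, 0 <= c &
  forall w, N (of_real_coords w) <= c * \sum_k `|w 0 k|.
Proof.
pose c := \sum_j N (col j (1%:M : 'M[R[i]]_p)).
have N0 v : 0 <= N v by exact: is_norm_ge0.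
exists c => [|w]; first exact: sumr_ge0.
rewrite -[of_real_coords w]mul1mx; apply: le_trans (mulmx_norm_coord_le hN _ _) _.
rewrite /c mulr_suml; apply: ler_sum => j _.
rewrite mulrC ler_wpM2l // mxE; apply: le_trans (normc_le_ReIm _ _) _.
rewrite big_split_ord /= lerD //.
  by rewrite (bigD1 j) //= lerDl sumr_ge0.
by rewrite (bigD1 j) //= lerDl sumr_ge0.
Qed.

(** The nontrivial half of the equivalence of norms: N is continuous for the
    maximum norm of the real coordinates, hence attains on the compact unit
    sphere a minimum, which is positive because N is definite. *)
Lemma real_coords_le_norm : exists2 c : R, 0 <= c &
  forall v k, `|real_coords v 0 k| <= c * N v.
Proof.
have [c c0 hc] := norm_of_real_coords_le.
pose g w := N (of_real_coords w).
have gcont : continuous g.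
  move=> w; apply/(@cvgrPdist_le _ _ _ (nbhs w)) => e e0.
  pose d := e / (c * (p + p)%:R + 1).
  have cp : 0 < c * (p + p)%:R + 1 by rewrite ltr_wpDl // mulr_ge0.
  have d0 : 0 < d by rewrite divr_gt0.
  have /(@cvgrPdist_le _ _ _ (nbhs w))/(_ d d0) : id w' @[w' --> w] --> w by exact: cvg_id.
  apply: filterS => w' ww'.
  have gdist : `|g w - g w'| <= N (of_real_coords (w - w')).
    rewrite ler_norml; apply/andP; split.
      rewrite lerNl opprB lerBlDr /g -{1}(subrK w w') of_real_coordsD.
      apply: le_trans (is_normD hN _ _) _.
      by rewrite lerD2r -(is_normN hN) -of_real_coordsN opprB.
    rewrite lerBlDr /g -{1}(subrK w' w) of_real_coordsD.
    exact: is_normD.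
  apply: le_trans gdist _; apply: le_trans (hc _) _.
  apply: (@le_trans _ _ (c * (\sum_(k < p + p) d))).
    rewrite ler_wpM2l //; apply: ler_sum => k _.
    exact: le_trans (coord_le_norm _ _) ww'.
  rewrite sumr_const card_ord -mulr_natr.
  have -> : c * (d * (p + p)%:R) = (e * (c * (p + p)%:R)) / (c * (p + p)%:R + 1).
    by rewrite /d; ring.
  by rewrite ler_pdivrMr // ler_wpM2l ?(ltW e0) // lerDl.
(* The unit sphere is empty in dimension 0; all coordinates then vanish. *)
have [[w0 w0n]|sph0] := pselect (exists w0 : 'rV[R]_(p + p), `|w0| = 1); last first.
  exists 0 => // v k; have [->|v0] := eqVneq (real_coords v) 0.
    by rewrite mxE normr0 mul0r.
  case: sph0; exists (`|real_coords v|^-1 *: real_coords v).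
  by rewrite normrZV // unitfE normr_eq0.
pose S := [set w : 'rV[R]_(p + p) | `|w| = 1].
have Sc : compact S.
  apply: bounded_closed_compact.
    exists 1; split; first exact: num_real.
    by move=> M M1 w /= ->; exact: ltW.
  have -> : S = (fun w : 'rV[R]_(p + p) => `|w|) @^-1` [set 1] by [].
  apply: closed_comp; last exact: closed_eq.
  by move=> w _; exact: norm_continuous.
have Sn0 : S !=set0 by exists w0.
have [m mS mmin] := compact_EVT_min Sn0 Sc (continuous_subspaceT gcont).
rewrite inE in mS.
have gm : 0 < g m.
  rewrite lt0r is_norm_ge0 // andbT; apply/eqP => /(is_norm_eq0 hN) m0.
  have := mS; rewrite /S /= -[m]of_real_coordsK m0 -of_real_coords0 of_real_coordsK.
  by rewrite normr0 => /eqP; rewrite eq_sym oner_eq0.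
exists (g m)^-1 => [|v k]; first by rewrite invr_ge0 ltW.
apply: le_trans (coord_le_norm _ _) _.
have [->|v0] := eqVneq (real_coords v) 0.
  by rewrite normr0 mulr_ge0 ?invr_ge0 ?is_norm_ge0 // ltW.
have vn : 0 < `|real_coords v| by rewrite normr_gt0.
have uS : `|real_coords v|^-1 *: real_coords v \in S.
  by rewrite inE /S /= normrZV // unitfE normr_eq0.
have := mmin _ uS; rewrite {2}/g of_real_coordsZ real_coordsK is_normZ //.
rewrite normc_real ger0_norm ?invr_ge0 ?(ltW vn) // => h.
by rewrite mulrC ler_pdivlMr // mulrC -ler_pdivlMr // mulrC.
Qed.

(** A supremum in the reals is meaningful only for a bounded set; here N v <= 1
    bounds the coordinates of v, hence N (A *m v). *)
Lemma opnormP (A : 'M[R[i]]_p) v : N (A *m v) <= opnorm N A * N v.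
Proof.
have [c c0 hc] := real_coords_le_norm.
have normc_le (u : 'cV[R[i]]_p) j : Normc.normc (u j 0) <= (c + c) * N u.
  have -> : u j 0 = real_coords u 0 (lshift p j) +i*
      real_coords u 0 (rshift p j).
    by rewrite row_mxEl row_mxEr !mxE; case: (u j 0).
  by apply: le_trans (normc_le_ReIm _ _) _; rewrite mulrDl lerD.
have ub u : N u <= 1 -> N (A *m u) <= \sum_j (c + c) * N (col j A).
  move=> u1; apply: le_trans (mulmx_norm_coord_le hN _ _) _.
  apply: ler_sum => j _; rewrite ler_wpM2r ?is_norm_ge0 //.
  by apply: le_trans (normc_le u j) _; rewrite ler_piMr // addr_ge0.
have [->|v0] := eqVneq v 0; first by rewrite mulmx0 is_norm0 // mulr0.
have nv : 0 < N v.
  by rewrite lt0r is_norm_ge0 // andbT; apply: contra_neq v0 => /(is_norm_eq0 hN).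
pose u := (N v)^-1%:C *: v.
have hu : N (A *m u) <= opnorm N A.
  apply: ub_le_sup.
    by exists (\sum_j (c + c) * N (col j A)) => _ [w w1 <-]; exact: ub.
  exists u => //=.
  rewrite is_normZ // normc_real ger0_norm ?invr_ge0 ?(ltW nv) //.
  by rewrite mulVf // gt_eqF.
move: hu; rewrite /u -scalemxAr is_normZ // normc_real.
by rewrite ger0_norm ?invr_ge0 ?(ltW nv) // mulrC ler_pdivrMr.
Qed.

End NormEquivalence.

(** * Convergence in norm *)

Section NormCvg.
Context {R : realType} {p : nat} (N : 'cV[R[i]]_p -> R) (hN : is_norm N).
Implicit Types (u v : nat -> 'cV[R[i]]_p) (l : 'cV[R[i]]_p).

Lemma norm_cvg_le u l (e : nat -> R) :
  (forall n, N (u n - l) <= e n) -> e n @[n --> \oo] --> (0 : R) ->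
  norm_cvg N u l.
Proof.
move=> ue e0; apply: squeeze_cvgr (cvg_cst 0) e0.
by apply: nearW => n; rewrite is_norm_ge0 ?ue.
Qed.

Lemma norm_cvg_cst l : norm_cvg N (fun=> l) l.
Proof.
apply: (@norm_cvg_le _ _ (fun=> 0)); last exact: cvg_cst.
by move=> n; rewrite subrr is_norm0.
Qed.

Lemma norm_cvgD u v l m : norm_cvg N u l -> norm_cvg N v m ->
  norm_cvg N (fun n => u n + v n) (l + m).
Proof.
move=> ul vm; apply: (@norm_cvg_le _ _ (fun n => N (u n - l) + N (v n - m))).
  by move=> n; rewrite opprD addrACA is_normD.
by rewrite -[0]addr0; exact: cvgD.
Qed.

Lemma norm_cvg_mulmx (A : 'M[R[i]]_p) u l : norm_cvg N u l ->
  norm_cvg N (fun n => A *m u n) (A *m l).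
Proof.
move=> ul; apply: (@norm_cvg_le _ _ (fun n => opnorm N A * N (u n - l))).
  by move=> n; rewrite -mulmxBr opnormP.
by rewrite -[0](mulr0 (opnorm N A)); apply: cvgM => //; exact: cvg_cst.
Qed.

Lemma norm_cvgN u l : norm_cvg N u l -> norm_cvg N (fun n => - u n) (- l).
Proof.
by move=> ul; apply: norm_cvg_le ul => n; rewrite -opprD is_normN.
Qed.

Lemma norm_cvg_bound u l (B : R) :
  (forall n, N (u n) <= B) -> norm_cvg N u l -> N l <= B.
Proof.
move=> uB ul; have h : B + N (u n - l) @[n --> \oo] --> B + 0.
  by apply: cvgD => //; exact: cvg_cst.
rewrite -[B]addr0; apply: ler_cvg_to (cvg_cst (N l)) h _.
apply: nearW => n /=; rewrite -[in leLHS](subKr (u n) l).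
by apply: le_trans (is_normB hN _ _) _; rewrite lerD2r.
Qed.

Lemma norm_limit_unique u l m : norm_cvg N u l -> norm_cvg N u m -> l = m.
Proof.
move=> ul um; apply/eqP; rewrite -subr_eq0; apply/eqP/(is_norm_eq0 hN).
apply/eqP; rewrite eq_le is_norm_ge0 // andbT.
have := norm_cvgD ul (norm_cvgN um).
under eq_fun do rewrite subrr.
by apply: norm_cvg_bound => n; rewrite is_norm0.
Qed.

Lemma norm_cvg_shift u l : norm_cvg N (fun n => u n.+1) l -> norm_cvg N u l.
Proof. by rewrite /norm_cvg (cvg_shiftS (fun n => N (u n - l))). Qed.

Lemma extraction_ge (phi : nat -> nat) : {homo phi : i j / (i < j)%N} ->
  forall n, (n <= phi n)%N.
Proof.
move=> phi_homo; elim=> // n IH; exact: leq_ltn_trans IH (phi_homo _ _ (ltnSn n)).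
Qed.

Lemma cvg_extraction (a : nat -> R) (phi : nat -> nat) (b : R) :
  {homo phi : i j / (i < j)%N} -> a n @[n --> \oo] --> b ->
  a (phi n) @[n --> \oo] --> b.
Proof.
move=> phi_homo; apply: cvg_comp => A [n0 _ hA]; exists n0 => // n /= n0n.
by apply: hA => /=; exact: leq_trans n0n (extraction_ge phi_homo n).
Qed.

Lemma cvg_sum0 (m : nat) (F : 'I_m -> nat -> R) :
  (forall k, F k n @[n --> \oo] --> (0 : R)) ->
  \sum_(k < m) F k n @[n --> \oo] --> (0 : R).
Proof.
elim: m F => [|m IH] F F0; under eq_fun do rewrite ?big_ord0 ?big_ord_recr /=.
  exact: cvg_cst.
have IH' := IH _ (fun k => F0 (widen_ord (leqnSn m) k)).
by have := @cvgD _ _ _ \oo _ _ _ _ _ IH' (F0 ord_max); rewrite addr0; apply.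
Qed.

End NormCvg.

(** * Series dominated by a geometric series *)

Section GeometricSeries.
Context {R : realType} {p : nat} (N : 'cV[R[i]]_p -> R) (hN : is_norm N).
Variables (M r : R) (M_ge0 : 0 <= M) (r_ge0 : 0 <= r) (r_lt1 : r < 1).
Implicit Types (u : nat -> 'cV[R[i]]_p) (s : 'cV[R[i]]_p).

(** Completeness of C^p for N: each real coordinate of the series is absolutely
    convergent, and coordinatewise convergence implies convergence in N. *)
Lemma geometric_summable u :
  (forall j, N (u j) <= M * r ^+ j) -> exists s, norm_cvg N (series u) s.
Proof.
move=> uM; have [c c0 hc] := real_coords_le_norm hN.
have [d d0 hd] := norm_of_real_coords_le hN.
have cvg_coord k : cvgn (series (fun j => real_coords (u j) 0 k)).
  apply: normed_cvg; apply: (@series_le_cvg _ _ (geometric (c * M) r)).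
  - by move=> j /=.
  - by move=> j; apply: geometric_ge0; rewrite ?mulr_ge0.
  - move=> j /=; apply: le_trans (hc _ _) _.
    by rewrite -mulrA ler_wpM2l.
  - by apply: is_cvg_geometric_series; rewrite ger0_norm.
pose w := \row_k limn (series (fun j => real_coords (u j) 0 k)).
have coord_series n k : real_coords (series u n) 0 k =
    series (fun j => real_coords (u j) 0 k) n.
  elim: n => [|n IH].
    rewrite /series /= !big_geq //.
    by rewrite -[0 in LHS]of_real_coords0 of_real_coordsK mxE.
  by rewrite !seriesSr real_coordsD mxE IH.
exists (of_real_coords w).
apply: (norm_cvg_le hN
  (e := fun n => d * \sum_k `|real_coords (series u n) 0 k - w 0 k|)) => [n|].
  rewrite -[in X in X <= _](real_coordsK (series u n)).
  rewrite -of_real_coordsN -of_real_coordsD.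
  apply: le_trans (hd _) _; rewrite ler_wpM2l // ler_sum // => k _.
  by rewrite !mxE.
rewrite -[X in _ --> X](mulr0 d); apply: cvgM; first exact: cvg_cst.
apply: cvg_sum0 => k; under eq_fun do rewrite coord_series mxE.
by apply/norm_cvg0P/subr_cvg0.
Qed.

(** The head is kept exact because in the dominated convergence argument it
    tends to 0 for fixed J, while the tail is small uniformly in the series. *)
Lemma geometric_series_tail u s (J : nat) :
  (forall j, N (u j) <= M * r ^+ j) -> norm_cvg N (series u) s ->
  N s <= \sum_(j < J) N (u j) + M * r ^+ J / (1 - r).
Proof.
move=> uM; have r1 : 0 < 1 - r by rewrite subr_gt0.
apply: norm_cvg_bound => // n; rewrite /series /= big_mkord.
apply: le_trans (is_norm_sum hN _ _ _) _.
have [nJ|/ltnW Jn] := leqP n J.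
  rewrite -(subnKC nJ) big_split_ord /= -addrA lerDl addr_ge0 //.
    by rewrite sumr_ge0 // => j _; exact: is_norm_ge0.
  by rewrite divr_ge0 ?(ltW r1) // mulr_ge0 ?exprn_ge0.
rewrite -(subnKC Jn); move: (n - J)%N => m.
rewrite big_split_ord /= lerD2l.
apply: (@le_trans _ _ (series (geometric (M * r ^+ J) r) m)).
  rewrite /series /= big_mkord; apply: ler_sum => j _.
  by apply: le_trans (uM _) _; rewrite exprD mulrA.
rewrite geometric_seriesE ?lt_eqF //= ler_pM2r ?invr_gt0 //.
by rewrite ler_piMr ?mulr_ge0 ?exprn_ge0 // gerBl exprn_ge0.
Qed.

Lemma geometric_series_le u s :
  (forall j, N (u j) <= M * r ^+ j) -> norm_cvg N (series u) s ->
  N s <= M / (1 - r).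
Proof.
move=> uM us; have := geometric_series_tail 0 uM us.
by rewrite big_ord0 add0r expr0 mulr1.
Qed.

End GeometricSeries.

(** Dominated convergence for series, with a geometric dominating sequence:
    the differences [U m j - u j] are dominated by [2 M r^j]; J is chosen to
    make their tails small, then m to make their heads small. *)
Lemma dominated_series_cvg {R : realType} {p : nat} (N : 'cV[R[i]]_p -> R)
    (hN : is_norm N) (M r : R) (M_ge0 : 0 <= M) (r_ge0 : 0 <= r) (r_lt1 : r < 1)
    (U : nat -> nat -> 'cV[R[i]]_p) (u s_ : nat -> 'cV[R[i]]_p)
    (s : 'cV[R[i]]_p) :
  (forall m j, N (U m j) <= M * r ^+ j) ->
  (forall j, norm_cvg N (fun m => U m j) (u j)) ->
  (forall m, norm_cvg N (series (U m)) (s_ m)) -> norm_cvg N (series u) s ->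
  norm_cvg N s_ s.
Proof.
move=> UM Uu Us us.
have uM j : N (u j) <= M * r ^+ j by apply: norm_cvg_bound (Uu j).
have dM m j : N (U m j - u j) <= (M + M) * r ^+ j.
  by apply: le_trans (is_normB hN _ _) _; rewrite mulrDl lerD.
have ds m : norm_cvg N (series (fun j => U m j - u j)) (s_ m - s).
  have -> : series (fun j => U m j - u j) = fun n => series (U m) n - series u n.
    by apply/funext => n; rewrite /series /= sumrB.
  by apply: norm_cvgD => //; exact: norm_cvgN.
have MM : 0 <= M + M by rewrite addr_ge0.
apply/(@cvgr0Pnorm_le _ R^o) => e e0.
have tail0 : (M + M) * r ^+ J / (1 - r) @[J --> \oo] --> (0 : R).
  rewrite -(mul0r (1 - r)^-1); apply: cvgM; last exact: cvg_cst.
  by apply: (@cvg_geometric R (M + M) r); rewrite ger0_norm.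
have e2 : 0 < e / 2 by rewrite divr_gt0.
have [J _ /(_ J (leqnn J)) /= hJ] := cvgr_le _ tail0 _ e2.
have head0 : \sum_(j < J) N (U m j - u j) @[m --> \oo] --> (0 : R).
  by apply: (cvg_sum0 (F := fun j m => N (U m j - u j))) => j; exact: Uu.
have [m0 _ hm0] := cvgr_le _ head0 _ e2; exists m0 => // m /hm0 /= hm.
rewrite ger0_norm ?is_norm_ge0 //.
apply: le_trans (geometric_series_tail hN MM r_ge0 r_lt1 J (dM m) (ds m)) _.
by rewrite [leRHS](splitr e) lerD.
Qed.

(** Were f unbounded, some sequence of translates would satisfy
    [n < N (f (s' n))], yet by almost automorphy the values of f along a
    subsequence of s' converge. *)
Lemma almost_automorphic_bounded {R : realType} {p : nat} (N : 'cV[R[i]]_p -> R)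
    (hN : is_norm N) (f : int -> 'cV[R[i]]_p) :
  almost_automorphic N f -> exists2 B : R, 0 <= B & forall n, N (f n) <= B.
Proof.
move=> faa; have [[B hB]|unb] := pselect (exists B : R, forall n, N (f n) <= B).
  by exists B => //; apply: le_trans (hB 0); exact: is_norm_ge0.
have /choice[s' hs'] (n : nat) : exists k, n%:R < N (f k).
  apply: contrapT => h; apply: unb; exists n%:R => k; rewrite leNgt.
  by apply/negP => hk; apply: h; exists k.
have [phi phi_homo [ft /(_ 0)[h _]]] := faa s'.
have [n0 _ /= hn0] := cvgr_le _ h _ (ltr01 : (0 : R) < 1).
pose n := maxn n0 (Num.truncn (N (ft 0) + 1)).+1.
have := hn0 n (leq_maxl _ _); rewrite add0r => hn.
have : N (f (s' (phi n))) <= N (ft 0) + 1.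
  rewrite -(subrK (ft 0) (f _)); apply: le_trans (is_normD hN _ _) _.
  by rewrite addrC lerD2l.
rewrite leNgt => /negP[]; apply: lt_trans (hs' _).
apply: lt_le_trans (truncnS_gt _) _; rewrite ler_nat.
exact: leq_trans (leq_maxr _ _) (extraction_ge phi_homo n).
Qed.

(** * Convolution with an exponentially decaying kernel *)

Section GreenConvolution.
Context {R : realType} {p : nat} (N : 'cV[R[i]]_p -> R) (hN : is_norm N).
Implicit Types (G : int -> int -> 'M[R[i]]_p) (f : int -> 'cV[R[i]]_p).
Implicit Types (n : int) (x : 'cV[R[i]]_p).

(** The estimate of the dichotomy, in the pointwise form that passes to limits
    of kernels without any continuity of the operator norm. *)
Definition decays (K q : R) G :=
  forall m l v, N (G m l *m v) <= K * q ^+ absz (m - l)%R * N v.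

(** The terms k = n - j - 1 of the series [sum_k G n (k + 1) *m f k]; the terms
    k = n + j form [future_term].  Numbering from the centre n makes the sum
    equivariant under translations. *)
Definition past_term G f n (j : nat) : 'cV[R[i]]_p :=
  G n (n - j%:Z) *m f (n - j%:Z - 1).

Definition future_term G f n (j : nat) : 'cV[R[i]]_p :=
  G n (n + 1 + j%:Z) *m f (n + j%:Z).

Definition green_conv G f n x := exists a b,
  [/\ norm_cvg N (series (past_term G f n)) a,
      norm_cvg N (series (future_term G f n)) b & x = a + b].

Lemma green_conv_shift G f (s n : int) x :
  green_conv G f (n + s) x <->
  green_conv (fun m l => G (m + s) (l + s)) (fun k => f (k + s)) n x.
Proof.
rewrite /green_conv.
have -> : past_term (fun m l => G (m + s) (l + s)) (fun k => f (k + s)) n =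
    past_term G f (n + s).
  by apply/funext => j; congr (G _ _ *m f _); lia.
have -> // : future_term (fun m l => G (m + s) (l + s)) (fun k => f (k + s)) n =
    future_term G f (n + s).
by apply/funext => j; congr (G _ _ *m f _); lia.
Qed.

Lemma decays_translate K q G (s : int) :
  decays K q G -> decays K q (fun m l => G (m + s) (l + s)).
Proof.
move=> Gq m l v.
have -> : absz (m - l)%R = absz ((m + s) - (l + s))%R by lia.
exact: Gq.
Qed.

Section Decay.
Variables (K q B : R) (K_ge0 : 0 <= K) (q_ge0 : 0 <= q) (q_lt1 : q < 1).
Hypothesis B_ge0 : 0 <= B.

Lemma past_term_le G f n j : decays K q G -> (forall k, N (f k) <= B) ->
  N (past_term G f n j) <= K * B * q ^+ j.
Proof.
move=> Gq fB; apply: le_trans (Gq _ _ _) _.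
have -> : absz (n - (n - j%:Z))%R = j by lia.
by rewrite mulrAC ler_wpM2r ?exprn_ge0 // ler_wpM2l.
Qed.

Lemma future_term_le G f n j : decays K q G -> (forall k, N (f k) <= B) ->
  N (future_term G f n j) <= K * q * B * q ^+ j.
Proof.
move=> Gq fB; apply: le_trans (Gq _ _ _) _.
have -> : absz (n - (n + 1 + j%:Z))%R = j.+1 by lia.
have -> : K * q * B * q ^+ j = K * q ^+ j.+1 * B by rewrite exprS; ring.
by rewrite ler_wpM2l // mulr_ge0 ?exprn_ge0.
Qed.

Let KB_ge0 : 0 <= K * B. Proof. exact: mulr_ge0. Qed.
Let KqB_ge0 : 0 <= K * q * B. Proof. by rewrite !mulr_ge0. Qed.

Lemma green_conv_exists G f : decays K q G -> (forall k, N (f k) <= B) ->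
  exists x : int -> 'cV[R[i]]_p, forall n, green_conv G f n (x n).
Proof.
move=> Gq fB.
suff /choice[x hx] n : exists x, green_conv G f n x by exists x.
have [a ha] := geometric_summable hN KB_ge0 q_ge0 q_lt1
  (fun j => past_term_le n j Gq fB).
have [b hb] := geometric_summable hN KqB_ge0 q_ge0 q_lt1
  (fun j => future_term_le n j Gq fB).
by exists (a + b), a, b.
Qed.

Lemma green_conv_le G f n x : decays K q G -> (forall k, N (f k) <= B) ->
  green_conv G f n x -> N x <= K * (1 + q) * (1 - q)^-1 * B.
Proof.
move=> Gq fB [a [b [ha hb ->]]]; apply: le_trans (is_normD hN _ _) _.
have -> : K * (1 + q) * (1 - q)^-1 * B = K * B / (1 - q) + K * q * B / (1 - q).
  by ring.
by apply: lerD; [apply: geometric_series_le ha | apply: geometric_series_le hb];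
  rewrite // => j; [exact: past_term_le | exact: future_term_le].
Qed.

(** Convergence of kernels and of bounded inputs, entry by entry, implies
    convergence of the convolutions: each term converges and all terms share
    the same geometric domination. *)
Lemma green_conv_cvg (H_ : nat -> int -> int -> 'M[R[i]]_p)
    (g_ : nat -> int -> 'cV[R[i]]_p) (x_ : nat -> 'cV[R[i]]_p) H g n x :
  (forall m, decays K q (H_ m)) -> (forall m k, N (g_ m k) <= B) ->
  (forall k l, norm_cvg (opnorm N) (fun m => H_ m k l) (H k l)) ->
  (forall k, norm_cvg N (fun m => g_ m k) (g k)) ->
  (forall m, green_conv (H_ m) (g_ m) n (x_ m)) -> green_conv H g n x ->
  norm_cvg N x_ x.
Proof.
move=> Hq gB HH gg Hx [a [b [ha hb ->]]].
have term_cvg k l i : norm_cvg N (fun m => H_ m k l *m g_ m i) (H k l *m g i).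
  apply: (norm_cvg_le hN (e := fun m => K * q ^+ absz (k - l)%R * N (g_ m i - g i)
                + opnorm N (H_ m k l - H k l) * N (g i))) => [m|].
    have -> : H_ m k l *m g_ m i - H k l *m g i =
        H_ m k l *m (g_ m i - g i) + (H_ m k l - H k l) *m g i.
      by rewrite mulmxBr mulmxBl addrA subrK.
    apply: le_trans (is_normD hN _ _) _; apply: lerD; first exact: Hq.
    exact: opnormP.
  rewrite -[X in _ --> X]addr0; apply: cvgD.
    rewrite -[X in _ --> X](mulr0 (K * q ^+ absz (k - l)%R)).
    by apply: cvgM; [exact: cvg_cst|exact: gg].
  rewrite -[X in _ --> X](mul0r (N (g i))).
  by apply: cvgM; [exact: HH|exact: cvg_cst].
have /choice[a_ /choice[b_ hab]] m := Hx m.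
have -> : x_ = fun m => a_ m + b_ m by apply/funext => m; case: (hab m).
apply: norm_cvgD => //.
  apply: (dominated_series_cvg hN KB_ge0 q_ge0 q_lt1 _ _ _ ha).
  - by move=> m j; exact: past_term_le.
  - by move=> j; exact: term_cvg.
  - by move=> m; case: (hab m).
apply: (dominated_series_cvg hN KqB_ge0 q_ge0 q_lt1 _ _ _ hb).
- by move=> m j; exact: future_term_le.
- by move=> j; exact: term_cvg.
- by move=> m; case: (hab m).
Qed.

Lemma decays_limit (H_ : nat -> int -> int -> 'M[R[i]]_p) H :
  (forall m, decays K q (H_ m)) ->
  (forall k l, norm_cvg (opnorm N) (fun m => H_ m k l) (H k l)) -> decays K q H.
Proof.
move=> Hq HH k l v; apply: (norm_cvg_bound hN (u := fun m => H_ m k l *m v)).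
  by move=> m; exact: Hq.
apply: (norm_cvg_le hN (e := fun m => opnorm N (H_ m k l - H k l) * N v)) => [m|].
  by rewrite -mulmxBl opnormP.
by rewrite -[X in _ --> X](mul0r (N v)); apply: cvgM; [exact: HH|exact: cvg_cst].
Qed.

(** A subsequence good for G is refined into one good for f as well.  The limits
    Gt and ft inherit the decay and the bound, so their convolution xt exists;
    it is the limit of the translates of x, and translating it back gives x. *)
Lemma green_conv_almost_automorphic G f (x : int -> 'cV[R[i]]_p) :
  decays K q G -> bi_almost_automorphic (opnorm N) G ->
  (forall k, N (f k) <= B) -> almost_automorphic N f ->
  (forall n, green_conv G f n (x n)) -> almost_automorphic N x.
Proof.
move=> Gq Gaa fB faa hx s'.
have [phi phi_homo [Gt hGt]] := Gaa s'.
have [psi psi_homo [ft hft]] := faa (s' \o phi).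
have Gt_cvg k l : norm_cvg (opnorm N)
    (fun m => G (k + s' (phi (psi m))) (l + s' (phi (psi m)))) (Gt k l).
  exact: (cvg_extraction psi_homo (hGt k l).1).
have G_cvg k l : norm_cvg (opnorm N)
    (fun m => Gt (k - s' (phi (psi m))) (l - s' (phi (psi m)))) (G k l).
  exact: (cvg_extraction psi_homo (hGt k l).2).
have Gtq : decays K q Gt.
  by apply: decays_limit Gt_cvg => m; exact: decays_translate.
have ftB k : N (ft k) <= B by apply: norm_cvg_bound (hft k).1.
have [xt hxt] := green_conv_exists Gtq ftB.
exists (phi \o psi) => [i j ij|]; first exact/phi_homo/psi_homo.
exists xt => n; split.
  apply: (green_conv_cvg _ _ Gt_cvg (fun k => (hft k).1) _ (hxt n)).
  - by move=> m; exact: decays_translate.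
  - by move=> m k; exact: fB.
  - by move=> m; apply/green_conv_shift; exact: hx.
apply: (green_conv_cvg _ _ G_cvg (fun k => (hft k).2) _ (hx n)).
- by move=> m; exact: (decays_translate (- s' (phi (psi m))) Gtq).
- by move=> m k; exact: ftB.
- by move=> m; apply/(green_conv_shift Gt ft (- s' (phi (psi m)))); exact: hxt.
Qed.

End Decay.

(** Passing from n to n + 1 moves exactly one term, k = n, from the future to the
    past and multiplies all others by C n; the jump of G across the diagonal
    makes that term contribute f n. *)
Lemma green_conv_solution (C : int -> 'M[R[i]]_p) G f (x : int -> 'cV[R[i]]_p) :
  (forall n l, G (n + 1) l = C n *m G n l + (l == n + 1)%:R%:M) ->
  (forall n, green_conv G f n (x n)) -> is_solution C f x.
Proof.
move=> GC hx n.
have [a [b [ha hb ->]]] := hx n; have [a1 [b1 [ha1 hb1 ->]]] := hx (n + 1).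
have past_step : a1 = G (n + 1) (n + 1) *m f n + C n *m a.
  refine (norm_limit_unique hN ha1 _); apply: norm_cvg_shift.
  have -> : (fun J => series (past_term G f (n + 1)) J.+1) =
      fun J => G (n + 1) (n + 1) *m f n + C n *m series (past_term G f n) J.
    apply/funext => J; rewrite /series /= !big_mkord big_ord_recl mulmx_sumr.
    congr (_ + _); first by rewrite /past_term subr0 addrK.
    apply: eq_bigr => j _; rewrite /past_term mulmxA.
    rewrite lift0.
    have -> : n + 1 - j.+1%:Z = n - j%:Z by lia.
    rewrite GC; have -> : (n - j%:Z == n + 1) = false by lia.
    by rewrite raddf0 addr0.
  exact: (norm_cvgD hN (norm_cvg_cst hN _) (norm_cvg_mulmx hN _ ha)).
have future_step : C n *m b = C n *m G n (n + 1) *m f n + b1.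
  refine (norm_limit_unique hN (norm_cvg_mulmx hN (C n) hb) _).
  apply: norm_cvg_shift.
  have -> : (fun J => C n *m series (future_term G f n) J.+1) =
      fun J => C n *m G n (n + 1) *m f n + series (future_term G f (n + 1)) J.
    apply/funext => J.
    rewrite /series /= !big_mkord big_ord_recl mulmxDr mulmx_sumr.
    congr (_ + _); first by rewrite mulmxA /future_term !addr0.
    apply: eq_bigr => j _; rewrite /future_term lift0 mulmxA.
    have -> : n + 1 + j.+1%:Z = n + 1 + 1 + j%:Z by lia.
    have -> : n + j.+1%:Z = n + 1 + j%:Z by lia.
    rewrite GC; have -> : (n + 1 + 1 + j%:Z == n + 1) = false by lia.
    by rewrite raddf0 addr0.
  exact: (norm_cvgD hN (norm_cvg_cst hN _) hb1).
rewrite mulmxDr past_step future_step GC eqxx mulmxDl mul1mx.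
by apply/colP => i; rewrite !mxE; ring.
Qed.

(** Substituting [f k = x (k + 1) - C k *m x k] makes the series telescope with
    increments of [T k = G n k *m x k], apart from the diagonal jump x n at
    k = n; boundedness of x and decay of G kill T at both ends. *)
Lemma bounded_solution_int_sum (C : int -> 'M[R[i]]_p) G f
    (x : int -> 'cV[R[i]]_p) (K q B : R) :
  0 <= K -> 0 < q -> q < 1 -> decays K q G ->
  (forall n k, G n (k + 1) *m C k = G n k - (k == n)%:R%:M) ->
  (forall n, N (x n) <= B) -> is_solution C f x ->
  forall n, int_sum N (fun k => G n (k + 1) *m f k) (x n).
Proof.
move=> K0 q0 q1 Gq GC xB xsol n.
pose T k := G n k *m x k.
have step k : G n (k + 1) *m f k = T (k + 1) - T k + (k == n)%:R *: x n.
  rewrite /T xsol mulmxDr mulmxA GC mulmxBl mul_scalar_mx.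
  have -> : (k == n)%:R *: x k = (k == n)%:R *: x n.
    by case: eqVneq => [->|_] //; rewrite !scale0r.
  move: (G n k *m x k) (_ *: x n) (_ *m f k) => a d g.
  by rewrite addrAC [a - d + g]addrAC subrK addrAC subrr add0r.
(* q ^ |n - k| <= q ^ |k| / q ^ |n|, by the triangle inequality. *)
have Tdecay k : N (T k) <= (K * B / q ^+ absz n) * q ^+ absz k.
  have B0 : 0 <= B by apply: le_trans (xB 0); exact: is_norm_ge0.
  apply: le_trans (Gq _ _ _) _.
  apply: (@le_trans _ _ (K * q ^+ absz (n - k)%R * B)).
    by rewrite ler_wpM2l // mulr_ge0 // exprn_ge0 // ltW.
  rewrite mulrAC -!mulrA !ler_wpM2l // ler_pdivlMl ?exprn_gt0 // -exprD.
  by apply: ler_wiXn2l; [exact: ltW | exact: ltW | lia].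
have Tcvg (k : nat -> int) : (forall J, absz (k J)%R = J) ->
    norm_cvg N (fun J => T (k J)) 0.
  move=> kJ; apply: (norm_cvg_le hN (e := geometric (K * B / q ^+ absz n) q)).
    by move=> J; rewrite subr0 -[in leRHS](kJ J).
  by apply: cvg_geometric; rewrite ger0_norm // ltW.
have stationary (b : nat -> bool) (b0 : bool) :
    (forall J, (absz n < J)%N -> b J = b0) ->
    norm_cvg N (fun J => (b J)%:R *: x n) (b0%:R *: x n).
  move=> bE; apply: cvg_near_cst; exists (absz n).+1 => // J /= nJ.
  by rewrite bE // subrr is_norm0.
(* The jump x n belongs to the series over k >= 0 or to the one over k < 0,
   according to the sign of n. *)
pose pos := (0 <= n)%R; pose neg := (n < 0)%R.
exists (- T 0 + pos%:R *: x n), (T 0 + neg%:R *: x n); split.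
- have -> : series (fun j : nat => G n (j%:Z + 1) *m f j%:Z) = fun J =>
      T J%:Z + (- T 0 + (pos && (n < J%:Z)%R)%:R *: x n).
    apply/funext; elim=> [|J IH].
      rewrite /series /= big_geq // addrA subrr add0r.
      by have -> : pos && (n < 0)%R = false; [lia | rewrite scale0r].
    rewrite seriesSr IH step; have -> : J.+1%:Z = J%:Z + 1 by lia.
    have -> : (pos && (n < J%:Z + 1)%R)%:R =
        (pos && (n < J%:Z)%R)%:R + (J%:Z == n)%:R :> R[i].
      by rewrite -natrD; congr (_%:R); rewrite /pos; lia.
    rewrite scalerDl; move: (T J%:Z) (T (J%:Z + 1)) (T 0) => t1 t2 t0.
    move: (_ *: x n) (_ *: x n) => y z.
    by apply/colP => i; rewrite !mxE; ring.
  rewrite -[X in norm_cvg _ _ X]add0r; apply: (norm_cvgD hN); first exact: Tcvg.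
  apply: (norm_cvgD hN); first exact: norm_cvg_cst.
  by apply: stationary => J; rewrite /pos; lia.
- have -> : series (fun j : nat => G n (Negz j + 1) *m f (Negz j)) = fun J =>
      - T (- J%:Z) + (T 0 + (neg && (- J%:Z <= n)%R)%:R *: x n).
    apply/funext; elim=> [|J IH].
      rewrite /series /= big_geq // oppr0 addrA addNr add0r.
      by have -> : neg && (0 <= n)%R = false; [lia | rewrite scale0r].
    rewrite seriesSr IH step; have -> : Negz J + 1 = - J%:Z by lia.
    have -> : Negz J = - J.+1%:Z by lia.
    have -> : (neg && (- J.+1%:Z <= n)%R)%:R =
        (neg && (- J%:Z <= n)%R)%:R + (- J.+1%:Z == n)%:R :> R[i].
      by rewrite -natrD; congr (_%:R); rewrite /neg; lia.
    rewrite scalerDl; move: (T (- J%:Z)) (T (- J.+1%:Z)) (T 0) => t1 t2 t0.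
    move: (_ *: x n) (_ *: x n) => y z.
    by apply/colP => i; rewrite !mxE; ring.
  rewrite -[X in norm_cvg _ _ X]add0r; apply: (norm_cvgD hN).
    have absN J : absz (- J%:Z)%R = J by lia.
    rewrite -[X in norm_cvg _ _ X]oppr0.
    exact: (norm_cvgN hN (Tcvg _ absN)).
  apply: (norm_cvgD hN); first exact: norm_cvg_cst.
  by apply: stationary => J; rewrite /neg; lia.
- rewrite addrACA addNr add0r -scalerDl -natrD.
  by have -> : (pos + neg = 1)%N; [rewrite /pos /neg; lia | rewrite scale1r].
Qed.

End GreenConvolution.

(** * The discrete Green function of an exponential dichotomy *)

Section GreenIdentities.
Context {R : realType} {p : nat} (C Y : int -> 'M[R[i]]_p) (P : 'M[R[i]]_p).
Hypothesis fundY : fundamental_matrix C Y.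

(** Off the diagonal both branches solve the homogeneous equation in the first
    argument; between them they jump by Y P Y^-1 + Y (I - P) Y^-1 = I. *)
Lemma green_recl (n l : int) :
  green Y P (n + 1) l = C n *m green Y P n l + (l == n + 1)%:R%:M.
Proof.
rewrite /green; have [_ YS] := fundY n; have [Yunit _] := fundY (n + 1).
have [ln|ln|->] := ltrgtP l (n + 1).
- have -> : (l <= n)%R by lia.
  by rewrite raddf0 addr0 YS !mulmxA.
- have -> : (l <= n)%R = false by lia.
  by rewrite raddf0 addr0 YS mulmxN !mulmxA.
- have -> : (n + 1 <= n)%R = false by lia.
  by rewrite mulmxN !mulmxA -YS mulmxBr mulmxBl mulmx1 mulmxV // opprB subrK.
Qed.

(** The dual recursion, in the second argument: it rests on
    Y(k+1)^-1 C(k) = Y(k)^-1. *)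
Lemma green_recr (n k : int) :
  green Y P n (k + 1) *m C k = green Y P n k - (k == n)%:R%:M.
Proof.
rewrite /green; have [Yk YS] := fundY k; have [YkS _] := fundY (k + 1).
have YC : invmx (Y (k + 1)) *m C k = invmx (Y k).
  by rewrite -[C k](mulmxK Yk) -YS mulmxA mulVmx // mul1mx.
have [kn|kn|<-] := ltrgtP k n.
- have -> : (k + 1 <= n)%R by lia.
  by rewrite raddf0 subr0 -!mulmxA YC.
- have -> : (k + 1 <= n)%R = false by lia.
  by rewrite raddf0 subr0 mulNmx -!mulmxA YC.
- have -> : (k + 1 <= k)%R = false by lia.
  rewrite mulNmx -!mulmxA YC mulmxA mulmxBr mulmxBl mulmx1 mulmxV //.
  by rewrite opprB mulmxA.
Qed.

End GreenIdentities.

Lemma exp_dichotomy_decays (R : realType) (p : nat) (N : 'cV[R[i]]_p -> R)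
    (hN : is_norm N) (C Y : int -> 'M[R[i]]_p) (alpha K : R) (P : 'M[R[i]]_p) :
  exp_dichotomy N C Y alpha K P -> decays N K (expR (- alpha)) (green Y P).
Proof.
case=> _ _ _ _ hG m l v; apply: le_trans (opnormP hN _ _) _.
rewrite ler_wpM2r ?is_norm_ge0 //; apply: le_trans (hG m l) _.
rewrite -expRM_natl [_ * - alpha]mulrC.
by have -> : `|m - l|%:~R = (absz (m - l)%R)%:R :> R by rewrite -abszE.
Qed.

Theorem theorem3p4 (R : realType) (p : nat) (hp : (1 <= p)%N)
    (N : 'cV[R[i]]_p -> R) (hN : is_norm N)
    (C : int -> 'M[R]_p)
    (hCaa : almost_automorphic (fun A => opnorm N (complexify A)) C)
    (hCinv : forall n, C n \in unitmx)
    (f : int -> 'cV[R[i]]_p) (hf : almost_automorphic N f)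
    (Y : int -> 'M[R[i]]_p) (alpha K : R) (P : 'M[R[i]]_p)
    (hdich : exp_dichotomy N (fun n => complexify (C n)) Y alpha K P)
    (hG : bi_almost_automorphic (opnorm N) (green Y P)) :
  (exists! x : int -> 'cV[R[i]]_p,
     almost_automorphic N x /\ is_solution (fun n => complexify (C n)) f x) /\
  (forall x : int -> 'cV[R[i]]_p,
     almost_automorphic N x -> is_solution (fun n => complexify (C n)) f x ->
     (forall n, int_sum N (fun k => green Y P n (k + 1) *m f k) (x n)) /\
     (forall n, N (x n) <=
        K * (1 + expR (- alpha)) * (1 - expR (- alpha))^-1 * sup_norm N f)).
Proof.
have [fundY alpha_gt0 /ltW K_ge0 _ _] := hdich.
have Gdecays := exp_dichotomy_decays hN hdich.
set q := expR (- alpha) in Gdecays *.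
have q_gt0 : 0 < q by exact: expR_gt0.
have q_lt1 : q < 1 by rewrite expR_lt1 oppr_lt0.
have [B0 _ fB0] := almost_automorphic_bounded hN hf.
have fB n : N (f n) <= sup_norm N f.
  by apply: ub_le_sup; [exists B0 => _ [k _ <-]|exists n].
have sup_ge0 : 0 <= sup_norm N f by apply: le_trans (fB 0); exact: is_norm_ge0.
have [x xG] := green_conv_exists hN K_ge0 (ltW q_gt0) q_lt1 sup_ge0 Gdecays fB.
have xaa := green_conv_almost_automorphic hN K_ge0 (ltW q_gt0) q_lt1 sup_ge0
  Gdecays hG fB hf xG.
have xsol := green_conv_solution hN (green_recl P fundY) xG.
have repr y : almost_automorphic N y ->
    is_solution (fun n => complexify (C n)) f y ->
    forall n, int_sum N (fun k => green Y P n (k + 1) *m f k) (y n).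
  move=> /(almost_automorphic_bounded hN)[B _ yB] ysol.
  exact: (bounded_solution_int_sum hN K_ge0 q_gt0 q_lt1 Gdecays
    (green_recr P fundY) yB ysol).
have xuniq y : almost_automorphic N y ->
    is_solution (fun n => complexify (C n)) f y -> x = y.
  move=> yaa ysol; apply/funext => n.
  have [a [b [xa xb ->]]] := repr x xaa xsol n.
  have [a' [b' [ya yb ->]]] := repr y yaa ysol n.
  by rewrite (norm_limit_unique hN xa ya) (norm_limit_unique hN xb yb).
split=> [|y yaa ysol].
  by exists x; split=> // y [yaa ysol]; exact: xuniq.
split=> [n|n]; first exact: repr.
rewrite -(xuniq y yaa ysol).
exact: (green_conv_le hN K_ge0 (ltW q_gt0) q_lt1 sup_ge0 Gdecays fB (xG n)).
Qed.
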